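(* There is an absolute constant $c>0$ such that whenever $s \ge c/\sqrt{\epsilon}$, any randomized protocol that succeeds with probability at least $0.99$ for solving $(1+\epsilon)$-approximate $\ell_2$ regression in the blackboard model requires $\Omega(d/\sqrt{\epsilon})$ bits of communication.
   Context: Distributed $\ell_2$ regression: $s$ servers $P_1,\dots,P_s$; server $P_i$ holds $A^{(i)}\in\mathbb{R}^{n_i\times d}$ and $b^{(i)}\in\mathbb{R}^{n_i}$ with integer entries; $A$ and $b$ are the vertical stackings of these. The coordinator must output $x\in\mathbb{R}^d$ with $\|Ax-b\|_2 \le (1+\epsilon)\min_{x'}\|Ax'-b\|_2$. In the blackboard model all messages are broadcast on a shared blackboard whose contents determine who speaks next; communication is the total number of bits written. *)

(* Defs.v *)
From HB Require Import structures.
From mathcomp Require Export all_boot all_order all_algebra.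
From mathcomp Require Export all_classical all_reals all_analysis.

Set Implicit Arguments.
Unset Strict Implicit.
Unset Printing Implicit Defensive.

Import Order.TTheory GRing.Theory Num.Theory.
Local Open Scope classical_set_scope.
Local Open Scope ring_scope.

(* The canonical norm on matrices in MathComp-Analysis is the sup norm, hence
   an explicit Euclidean norm. *)
Definition l2norm (R : realType) (m : nat) (v : 'cV[R]_m) : R :=
  Num.sqrt (\sum_i v i ord0 ^+ 2).

Definition lsq_opt (R : realType) (m d : nat) (A : 'M[R]_(m, d)) (b : 'cV[R]_m)
    : R :=
  inf [set l2norm (A *m x - b) | x in [set: 'cV[R]_d]].

Definition approx_lsq (R : realType) (m d : nat) (eps : R)
    (A : 'M[R]_(m, d)) (b : 'cV[R]_m) (x : 'cV[R]_d) : Prop :=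
  l2norm (A *m x - b) <= (1 + eps) * lsq_opt A b.

Definition server_data (m d : nat) : Type := ('M[int]_(m, d) * 'cV[int]_m)%type.

Definition instance (s d : nat) (n : 'I_s -> nat) : Type :=
  forall i : 'I_s, server_data (n i) d.

Definition stackA (R : realType) (s d : nat) (n : 'I_s -> nat)
    (X : instance d n) : 'M[R]_(\sum_i n i, d) :=
  map_mx intr (\mxcol_i (X i).1).

Definition stackb (R : realType) (s d : nat) (n : 'I_s -> nat)
    (X : instance d n) : 'cV[R]_(\sum_i n i) :=
  map_mx intr (\mxcol_i (X i).2).

(* Without a bound on the magnitude of the integer entries, no protocol of finite
   worst-case cost solves the problem (for d = 1, A = 1 and b a single integer,
   the output has to be b), and a lower bound would be vacuous. *)
Definition entries_bounded (s d : nat) (n : 'I_s -> nat) (M : nat)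
    (X : instance d n) : Prop :=
  forall (i : 'I_s) (r : 'I_(n i)),
    (forall j : 'I_d, `|(X i).1 r j| <= M%:Z) /\ `|(X i).2 r ord0| <= M%:Z.

(* The blackboard is the string of all bits written so far, oldest first.  It
   alone determines who writes the next bit (None: the protocol has stopped),
   and it is all the coordinator sees when producing the output.  A message of
   several bits is written by appointing the same server repeatedly; as only
   bits appear on the board, no information is carried for free by message
   boundaries. *)
Record protocol (R : realType) (s d : nat) (n : 'I_s -> nat) := Protocol {
  speaker : seq bool -> option 'I_s ;
  next_bit : forall i : 'I_s, server_data (n i) d -> seq bool -> bool ;
  output : seq bool -> 'cV[R]_d }.

Section Run.
Variables (R : realType) (s d : nat) (n : 'I_s -> nat).
Variables (pi : protocol R d n) (X : instance d n).

Definition turn (w : seq bool) : seq bool :=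
  if speaker pi w is Some i then rcons w (next_bit pi (X i) w) else w.

Definition board (t : nat) : seq bool := iter t turn [::].

Definition stops_with (x : 'cV[R]_d) : Prop :=
  exists2 t : nat, speaker pi (board t) = None & x = output pi (board t).

End Run.

(* A randomized protocol is a random deterministic protocol: the sample point is
   visible to everybody (public coins).  Private coins are the special case
   where each party only uses its own component of a product space. *)
Definition rprotocol (R : realType) (s d : nat) (n : 'I_s -> nat)
    (Omega : Type) : Type :=
  Omega -> protocol R d n.

Section Randomized.
Variables (R : realType) (s d : nat) (n : 'I_s -> nat).
Variables (disp : measure_display) (Omega : measurableType disp).
Variables (P : probability Omega R) (Pi : rprotocol R d n Omega).

Definition success_event (eps : R) (X : instance d n) : set Omega :=
  [set w | exists2 x : 'cV[R]_d, stops_with (Pi w) X x &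
             approx_lsq eps (stackA R X) (stackb R X) x].

Definition solves_regression (eps p : R) (M : nat) : Prop :=
  forall X : instance d n, entries_bounded M X ->
    measurable (success_event eps X) /\
    (p%:E <= P (success_event eps X))%E.

(* Worst case over the inputs and the coins of the number of bits ever written;
   a run that never stops writes unboundedly many bits. *)
Definition comm_at_most (M C : nat) : Prop :=
  forall X : instance d n, entries_bounded M X ->
    forall (w : Omega) (t : nat), (size (board (Pi w) X t) <= C)%N.

End Randomized.

(* Main.v *)
Require Import Defs.
From mathcomp Require Import all_boot all_order all_algebra.
From mathcomp Require Import all_classical all_reals all_analysis.
From mathcomp Require Import measurable_realfun ring lra zify.

Set Implicit Arguments.
Unset Strict Implicit.
Unset Printing Implicit Defensive.

Import Order.TTheory GRing.Theory Num.Theory.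
Local Open Scope ring_scope.

(* Let k ~ 1 / (16 sqrt eps) servers hold an identity block and a uniform bit
   vector in {0,1}^d, the other servers zeros.  The cost of x exceeds the optimum
   by k |x - mean|^2 in squares, so an accurate x determines the column sums up to
   average squared error 1/256; hence two inputs that are solved by the same x and
   differ at one server only are at Hamming distance at most d/64.
   A transcript of a deterministic protocol is reached on a rectangle
   S_1 x ... x S_k of inputs.  Rectangles with all |S_i| <= (3/2)^d cover at most
   2^(C+1) (3/2)^(dk) of the 2^(dk) inputs.  In any other rectangle, each line in a
   direction i with |S_i| > (3/2)^d contains at most a Hamming ball, i.e. (9/8)^d,
   of solved inputs, so at most a fraction (3/4)^d of it is solved.  Averaging over
   the coins gives C >= dk/15. *)

(** * Counting in combinatorial rectangles *)

Definition upd (I : finType) (T : Type) (f : {ffun I -> T}) (i : I) (u : T)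
    : {ffun I -> T} :=
  [ffun j => if j == i then u else f j].

Section Rectangles.
Variables (I T L : finType) (tau : {ffun I -> T} -> L).

Definition fiber (l : L) : {set {ffun I -> T}} := [set f | tau f == l].

Definition shadow (i : I) (l : L) : {set T} :=
  [set f i | f : {ffun I -> T} in fiber l].

(** This makes every fiber a combinatorial rectangle: changing coordinates one at a time turns [f]
    into any mixture of [f] and [g] without leaving the fiber. *)
Definition exchangeable : Prop :=
  forall f g i, tau f = tau g -> tau (upd f i (g i)) = tau f.

Lemma upd_upd (f : {ffun I -> T}) i u v : upd (upd f i u) i v = upd f i v.
Proof. by apply/ffunP => j; rewrite !ffunE; case: eqP. Qed.

Lemma upd_id (f : {ffun I -> T}) i : upd f i (f i) = f.
Proof. by apply/ffunP => j; rewrite !ffunE; case: eqP => // ->. Qed.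

Lemma updE (f : {ffun I -> T}) i u : upd f i u i = u.
Proof. by rewrite ffunE eqxx. Qed.

(* By exchangeability each line in direction [i] that meets the fiber does so in
   a copy of the whole shadow, of which at most [B] points are in [G]. *)
Lemma card_fiber_line (G : {set {ffun I -> T}}) (i : I) (l : L)
    (R : realType) (B : R) :
  exchangeable ->
  (forall g, tau g = l -> #|[set u | upd g i u \in G :&: fiber l]|%:R <= B) ->
  #|G :&: fiber l|%:R * #|shadow i l|%:R <= #|fiber l|%:R * B.
Proof.
move=> ex ball; rewrite -natrM -cardsX.
(* Swapping the new coordinate with the old one is an involution in substance, hence injective. It
   turns solved points paired with shadow values into fiber points paired with a value that leads
   into [G]. *)
pose h (p : {ffun I -> T} * T) := (upd p.1 i p.2, p.1 i).
have hinj : injective h.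
  move=> [f u] [g v] [] /= e1 e2.
  have euv : u = v by rewrite -(updE f i u) e1 updE.
  by rewrite -(upd_id f i) -(upd_id g i) e2 -(upd_upd f i u) e1 upd_upd euv.
rewrite -(card_imset _ hinj).
pose Q := [set p : {ffun I -> T} * T |
  (p.1 \in fiber l) && (upd p.1 i p.2 \in G :&: fiber l)].
apply: (@le_trans _ _ #|Q|%:R).
  rewrite ler_nat; apply/subset_leq_card/fintype.subsetP => p /imsetP[[f u] fu ->{p}]; move: fu.
  rewrite finset.in_setX => /andP[/= fG /imsetP[g gl eu]].
  rewrite /Q inE /= upd_upd upd_id fG andbT.
  move: fG gl; rewrite !inE eu => /andP[_ /eqP fl] /eqP gl.
  by rewrite ex ?fl ?gl.
rewrite -sum1_card.
rewrite (eq_bigl (fun p => (p.1 \in fiber l) &&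
  (upd p.1 i p.2 \in G :&: fiber l))); last by move=> p; rewrite inE.
rewrite -(pair_big_dep (mem (fiber l))
  (fun (f : {ffun I -> T}) (u : T) => upd f i u \in G :&: fiber l)
  (fun _ _ => 1%N)) /=.
rewrite natr_sum mulr_natl -sumr_const.
apply: ler_sum => f; rewrite inE => /eqP fl; apply: le_trans (ball f fl).
by rewrite sum1_card ler_nat; apply/eq_leq/eq_card => u; rewrite inE.
Qed.

Lemma card_fiber_prod (l : L) : (#|fiber l| <= \prod_i #|shadow i l|)%N.
Proof.
have -> : (\prod_i #|shadow i l|)%N = #|family (fun i => mem (shadow i l))|.
  by rewrite card_family foldrE big_map big_enum.
apply/subset_leq_card/fintype.subsetP => f fl; apply/familyP => i.
exact: imset_f.
Qed.

(** The threshold [t] splits the fibers. If all shadows have size at most [t], the fiber itself has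
    at most [t ^+ #|I|] points; otherwise a direction with a larger shadow leaves at most a fraction
    [B / t] of the fiber in [G]. *)
Lemma card_rectangle_cover (R : realType) (G : {set {ffun I -> T}}) (B t : R) :
  0 <= B -> 0 < t -> exchangeable ->
  (forall g i, #|[set u | upd g i u \in G :&: fiber (tau g)]|%:R <= B) ->
  #|G|%:R <= #|L|%:R * t ^+ #|I| + B / t * #|T|%:R ^+ #|I|.
Proof.
move=> B0 t0 ex ball.
have sumfib (A : {set {ffun I -> T}}) : #|A| = (\sum_l #|A :&: fiber l|)%N.
  rewrite -sum1_card (partition_big tau predT) //=; apply: eq_bigr => l _.
  by rewrite -sum1_card; apply: eq_bigl => f; rewrite !inE.
have bnd l : #|G :&: fiber l|%:R <= t ^+ #|I| + B / t * #|fiber l|%:R.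
  have [/forallP small|] := boolP [forall i, #|shadow i l|%:R <= t :> R].
    apply: (@le_trans _ _ (t ^+ #|I|)); last first.
      by rewrite lerDl !mulr_ge0 // invr_ge0 ltW.
    apply: (@le_trans _ _ (\prod_i #|shadow i l|)%:R).
      rewrite ler_nat; apply: leq_trans (card_fiber_prod l).
      by rewrite subset_leq_card // finset.subsetIr.
    rewrite natr_prod -prodr_const; apply: ler_prod => i _.
    by rewrite ler0n small.
  rewrite negb_forall => /existsP[i]; rewrite -ltNge => big.
  apply: (@le_trans _ _ (B / t * #|fiber l|%:R)); last first.
    by rewrite lerDr exprn_ge0 // ltW.
  rewrite mulrAC ler_pdivlMr //.
  apply: (@le_trans _ _ (#|G :&: fiber l|%:R * #|shadow i l|%:R)).
    by rewrite ler_wpM2l // ltW.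
  rewrite [B * _]mulrC.
  by apply: card_fiber_line => // g <-; apply: ball.
rewrite (sumfib G) natr_sum.
apply: le_trans (ler_sum _ (fun l _ => bnd l)) _.
rewrite big_split /= sumr_const -[_ *+ #|L|]mulr_natl lerD2l -mulr_sumr -natr_sum.
apply: ler_wpM2l; first by rewrite divr_ge0 // ltW.
rewrite -natrX ler_nat -card_ffun.
rewrite -cardsT (sumfib finset.setT).
by apply/eq_leq/eq_bigr => l _; rewrite finset.setTI.
Qed.

End Rectangles.

(** * Volume of Hamming balls *)

Definition hamming (d : nat) (u v : {ffun 'I_d -> bool}) : nat :=
  #|[set j | u j != v j]|.

(* Chernoff-style: with weight [w = 18/17], [w ^ 64 >= 16] makes
   [w * (1 + w ^- 64) <= 9/8]. *)
Lemma card_hamming_ball (R : realType) (d : nat) (v : {ffun 'I_d -> bool}) :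
  #|[set u | (64 * hamming u v <= d)%N]|%:R <= (9 / 8 : R) ^+ d.
Proof.
pose w : R := 18 / 17; pose z : R := w ^- 64.
have w0 : 0 < w by rewrite /w; lra.
have z0 : 0 < z by rewrite invr_gt0 exprn_gt0.
have zle : z <= 16^-1.
  rewrite /z lef_pV2 ?posrE ?exprn_gt0 //.
  (* Repeated squaring, rounding down to small rationals each time. *)
  have w2 : 28 / 25 <= w ^+ 2 by rewrite /w expr2; lra.
  have w4 : 5 / 4 <= w ^+ 4 by rewrite -[4%N]/(2 * 2)%N exprM; nra.
  have w8 : 3 / 2 <= w ^+ 8 by rewrite -[8%N]/(4 * 2)%N exprM; nra.
  have w16 : 2 <= w ^+ 16 by rewrite -[16%N]/(8 * 2)%N exprM; nra.
  have w32 : 4 <= w ^+ 32 by rewrite -[32%N]/(16 * 2)%N exprM; nra.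
  by rewrite -[64%N]/(32 * 2)%N exprM; nra.
have hE u : z ^+ hamming u v = \prod_j (if u j != v j then z else 1).
  rewrite -big_mkcond /= prodr_const; congr (z ^+ _).
  by apply: eq_card => j; rewrite inE.
have -> : #|[set u | (64 * hamming u v <= d)%N]|%:R =
    \sum_(u in [set u | (64 * hamming u v <= d)%N]) (1 : R).
  by rewrite sumr_const.
(* In the ball the weight [w ^+ d * z ^+ hamming u v] is at least 1, because
   [64 * hamming u v <= d]; elsewhere it is nonnegative. *)
apply: (@le_trans _ _ (\sum_(u : {ffun 'I_d -> bool})
                         w ^+ d * z ^+ hamming u v)).
  rewrite [leRHS](bigID (mem [set u | (64 * hamming u v <= d)%N])) /=.
  rewrite -[leLHS]addr0 lerD //; last first.
    by apply: sumr_ge0 => u _; rewrite mulr_ge0 ?exprn_ge0 // ltW.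
  apply: ler_sum => u; rewrite inE => hu.
  rewrite /z exprVn -exprM ler_pdivlMr ?exprn_gt0 // mul1r.
  by apply: ler_weXn2l => //; rewrite /w; lra.
rewrite -mulr_sumr.
have -> : \sum_(u : {ffun 'I_d -> bool}) z ^+ hamming u v = (1 + z) ^+ d.
  under eq_bigr do rewrite hE.
  rewrite -(bigA_distr_bigA (fun j b => if b != v j then z else 1)) /=.
  rewrite -[in RHS](card_ord d) -prodr_const; apply: eq_bigr => j _.
  by rewrite big_bool /=; case: (v j); rewrite /= // addrC.
rewrite -exprMn; apply: lerXn2r; rewrite ?nnegrE; last by rewrite /w; nra.
  by rewrite mulr_ge0 ?addr_ge0 // ltW.
by lra.
Qed.

(** * Transcripts of a deterministic protocol *)

Section Transcripts.
Variables (R : realType) (s d : nat) (n : 'I_s -> nat) (pi : protocol R d n).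

(** A stopped board stays stopped, so a board that still has a speaker gained one bit at every turn:
    its length is the time. *)
Lemma size_board_speaking (X : instance d n) (t : nat) :
  speaker pi (board pi X t) -> size (board pi X t) = t.
Proof.
elim: t => [//|t IH]; rewrite /board iterS -/(board pi X t) /turn.
case E: (speaker pi (board pi X t)) => [i|]; last by rewrite E.
by rewrite size_rcons IH // E.
Qed.

Lemma size_board (X : instance d n) (t : nat) : (size (board pi X t) <= t)%N.
Proof.
elim: t => [//|t IH]; rewrite /board iterS -/(board pi X t) /turn.
by case: (speaker _ _) => [i|]; rewrite ?size_rcons // ltnW.
Qed.

Lemma take_board (X : instance d n) (t : nat) :
  take t (board pi X t.+1) = board pi X t.
Proof.
rewrite /board iterS -/(board pi X t) /turn.
case E: (speaker pi (board pi X t)) => [i|]; last exact/take_oversize/size_board.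
have sz : size (board pi X t) = t by apply: size_board_speaking; rewrite E.
by rewrite -cats1 take_size_cat.
Qed.

(** The board fixes the speaker, and the bit depends only on the board and on that server's data,
    which come from [X] or from [Y]; both of these runs write the same bit. *)
Lemma board_exchange (X Y Z : instance d n) (t : nat) :
  (forall i, Z i = X i \/ Z i = Y i) ->
  board pi X t = board pi Y t -> board pi Z t = board pi X t.
Proof.
move=> ZXY; elim: t => [//|t IH] e.
have e' : board pi X t = board pi Y t by rewrite -(take_board X) -(take_board Y) e.
move: e; rewrite /board !iterS -!/(board pi _ t) (IH e') -e' /turn.
case: (speaker _ _) => [i|//] e.
by case: (ZXY i) => -> //; rewrite e.
Qed.

Lemma board_stopped (X : instance d n) (t m : nat) :
  speaker pi (board pi X t) = None -> board pi X (m + t) = board pi X t.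
Proof.
move=> st; elim: m => [//|m IH].
by rewrite addSn /board iterS -/(board pi X _) IH /turn st.
Qed.

(** A speaker at time [C] would produce a board of [C + 1] bits, so the run is over by then. *)
Lemma stops_with_output (X : instance d n) (C : nat) (x : 'cV[R]_d) :
  (forall t, (size (board pi X t) <= C)%N) ->
  stops_with pi X x -> x = output pi (board pi X C).
Proof.
move=> le_C [t st ->]; congr output.
have stC : speaker pi (board pi X C) = None.
  case E: (speaker pi (board pi X C)) => [i|//].
  have := le_C C.+1; rewrite /board iterS -/(board pi X C) /turn E size_rcons.
  by rewrite size_board_speaking ?E // ltnn.
have [tC|Ct] := leqP t C; first by rewrite -(subnK tC) board_stopped.
by rewrite -(subnK (ltnW Ct)) board_stopped.
Qed.

End Transcripts.

Lemma card_transcripts (C : nat) : (#|{bseq C of bool}| < 2 ^ C.+1)%N.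
Proof.
rewrite card_bseq card_bool; elim: C => [|C IH]; first by rewrite big_ord1.
by rewrite big_ord_recr /= (expnS 2 C.+1) mul2n -addnn ltn_add2r.
Qed.

(** * Hard instances and their squared cost *)

Section HardInstances.
Variables (R : realType) (s d : nat) (n : 'I_s -> nat).
Hypothesis le_dn : forall i, (d <= n i)%N.

Lemma sum_sq_stack (X : instance d n) (x : 'cV[R]_d) :
  \sum_p ((stackA R X *m x - stackb R X) p ord0) ^+ 2 =
  \sum_i \sum_r ((map_mx intr (X i).1 *m x - map_mx intr (X i).2) r ord0) ^+ 2.
Proof.
rewrite (sig_big_dep xpredT (fun _ => xpredT) (fun i (r : 'I_(n i)) =>
  ((map_mx intr (X i).1 *m x - map_mx intr (X i).2) r ord0) ^+ 2)) /=.
rewrite (reindex (@tagnat.sig _ n)) /=; last exact: tagnat.sig_bij_on.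
apply: eq_bigr => p _; congr (_ ^+ 2).
rewrite !mxE; congr (_ - _).
by apply: eq_bigr => j _; rewrite !mxE.
Qed.

(** Rows from index [d] on are zero on both sides and cost nothing, so a server may have more than
    [d] rows. *)
Definition identity_block (m : nat) (u : {ffun 'I_d -> bool}) : server_data m d :=
  (\matrix_(r, j) (r == j :> nat)%:R,
   \col_r (oapp u false (insub (val r)))%:R).

Definition hard_instance (k : nat) (f : {ffun 'I_k -> {ffun 'I_d -> bool}})
    : instance d n :=
  fun i => if insub (val i) is Some i' then identity_block (n i) (f i')
           else (0, 0).

Lemma hard_instance_bounded (M k : nat) (f : {ffun 'I_k -> {ffun 'I_d -> bool}}) :
  (0 < M)%N -> entries_bounded M (hard_instance f).
Proof.
move=> M0 i r; rewrite /hard_instance; case: (insub _) => [i'|] /=; split.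
- by move=> j; rewrite mxE; case: (_ == _); rewrite ?normr1 ?normr0.
- by rewrite mxE; case: (oapp _ _ _); rewrite ?normr1 ?normr0.
- by move=> j; rewrite mxE normr0.
- by rewrite mxE normr0.
Qed.

Lemma hard_instance_upd (k : nat) (f g : {ffun 'I_k -> {ffun 'I_d -> bool}}) i i0 :
  hard_instance (upd f i (g i)) i0 = hard_instance f i0 \/
  hard_instance (upd f i (g i)) i0 = hard_instance g i0.
Proof.
rewrite /hard_instance; case: (insub _) => [j|]; last by left.
by rewrite ffunE; case: eqP => [->|_]; [right|left].
Qed.

Lemma sum_sq_identity_block (m : nat) (u : {ffun 'I_d -> bool}) (x : 'cV[R]_d) :
  (d <= m)%N ->
  \sum_r ((map_mx intr (identity_block m u).1 *m x -
           map_mx intr (identity_block m u).2) r ord0) ^+ 2 =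
  \sum_j (x j ord0 - (u j)%:R) ^+ 2.
Proof.
move=> le_dm.
(* Extension by zero to all naturals, so that sums over ['I_m] and ['I_d] can be compared. *)
pose F (r : nat) : R := if insub r is Some j then (x j ord0 - (u j)%:R) ^+ 2 else 0.
transitivity (\sum_(r < m) F r).
  apply: eq_bigr => r _; rewrite !mxE /F.
  have -> : \sum_j map_mx intr (identity_block m u).1 r j * x j ord0 =
            oapp (fun j => x j ord0) 0 (insub (val r)).
    case: insubP => [j _ jr|nr] /=.
      rewrite (bigD1 j) //= big1 => [|j' ne].
        by rewrite !mxE jr eqxx mul1r addr0.
      by rewrite !mxE -jr eq_sym (inj_eq val_inj) (negbTE ne) mul0r.
    rewrite big1 // => j _; rewrite !mxE.
    case: eqP => [e|_]; last by rewrite mul0r.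
    by move: nr => /=; rewrite e ltn_ord.
  case: insubP => [j _ _|_] /=; last by rewrite subrr expr0n.
  by case: (u j).
transitivity (\sum_(r < m | (r < d)%N) F r).
  rewrite [LHS](bigID (fun r : 'I_m => (r < d)%N)) /= addrC big1 ?add0r // => r.
  by rewrite /F; case: insubP => // j ->.
rewrite -(big_ord_widen _ _ le_dm); apply: eq_bigr => j _.
by rewrite /F valK.
Qed.

Lemma sum_sq_hard_instance (k : nat) (f : {ffun 'I_k -> {ffun 'I_d -> bool}})
    (x : 'cV[R]_d) : (k <= s)%N ->
  l2norm (stackA R (hard_instance f) *m x - stackb R (hard_instance f)) ^+ 2 =
  \sum_i \sum_j (x j ord0 - (f i j)%:R) ^+ 2.
Proof.
move=> le_ks; rewrite /l2norm sqr_sqrtr; last by apply: sumr_ge0 => p _; exact: sqr_ge0.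
rewrite sum_sq_stack.
pose F (i : nat) : R := if insub i is Some i' then
   \sum_j (x j ord0 - (f i' j)%:R) ^+ 2 else 0.
transitivity (\sum_(i < s) F i).
  apply: eq_bigr => i _; rewrite /F /hard_instance.
  case: (insub _) => [i'|]; first exact: sum_sq_identity_block.
  apply: big1 => r _; rewrite !mxE big1 ?subrr ?expr0n // => j _.
  by rewrite !mxE mul0r.
transitivity (\sum_(i < s | (i < k)%N) F i).
  rewrite [LHS](bigID (fun i : 'I_s => (i < k)%N)) /= addrC big1 ?add0r // => i.
  by rewrite /F; case: insubP => // j ->.
rewrite -(big_ord_widen _ _ le_ks); apply: eq_bigr => i _.
by rewrite /F valK.
Qed.

End HardInstances.

(** The parallel-axis identity; the mean [m] is specified by a product to avoid division. *)
Lemma sum_sq_mean (R : realType) (k : nat) (a : 'I_k -> R) (m y : R) :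
  k%:R * m = \sum_i a i ->
  \sum_i (y - a i) ^+ 2 = \sum_i (m - a i) ^+ 2 + k%:R * (y - m) ^+ 2.
Proof.
move=> km; apply/eqP; rewrite addrC -subr_eq; apply/eqP.
rewrite -sumrB.
rewrite (eq_bigr (fun i => (y - m) * (y + m) - (y - m) * 2 * a i)); last first.
  by move=> i _; ring.
rewrite sumrB sumr_const card_ord -mulr_natl -mulr_sumr -km.
by ring.
Qed.

(** * What an accurate output reveals about the input *)

Section Closeness.
Variables (R : realType) (s d : nat) (n : 'I_s -> nat).
Hypothesis le_dn : forall i, (d <= n i)%N.
Variables (k : nat) (eps : R).
Hypotheses (k_gt0 : (0 < k)%N) (le_ks : (k <= s)%N) (eps_gt0 : 0 < eps).
Hypothesis k_small : k = 1%N \/ eps * k%:R ^+ 2 <= 256^-1.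

Lemma lsq_opt_le (m : nat) (A : 'M[R]_(m, d)) (b : 'cV[R]_m) (y : 'cV[R]_d) :
  lsq_opt A b <= l2norm (A *m y - b).
Proof.
apply: ge_inf; last by exists y.
by exists 0 => _ [z _ <-]; rewrite sqrtr_ge0.
Qed.

(** The squared cost of [x] is [V + k * D x], with [V] its value at the column means. Accuracy gives
    [k * D x <= 3 * eps * V], and [V <= k * d / 4], so the scaled error [k ^ 2 * D x] is controlled
    by [eps * k ^ 2]. *)
Lemma approx_lsq_close (f : {ffun 'I_k -> {ffun 'I_d -> bool}}) (x : 'cV[R]_d) :
  approx_lsq eps (stackA R (hard_instance n f)) (stackb R (hard_instance n f)) x ->
  \sum_j (k%:R * x j ord0 - \sum_i (f i j)%:R) ^+ 2 <= d%:R / 256.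
Proof.
have k0 : 0 < k%:R :> R by rewrite ltr0n.
pose m : 'cV[R]_d := \col_j ((\sum_i (f i j)%:R) / k%:R).
pose V := \sum_i \sum_j (m j ord0 - (f i j)%:R) ^+ 2.
pose D (y : 'cV[R]_d) := \sum_j (y j ord0 - m j ord0) ^+ 2.
have mE j : k%:R * m j ord0 = \sum_i (f i j)%:R.
  by rewrite mxE mulrC divfK // gt_eqF.
have costE (y : 'cV[R]_d) : \sum_i \sum_j (y j ord0 - (f i j)%:R) ^+ 2 = V + k%:R * D y.
  rewrite /V /D exchange_big [in RHS]exchange_big mulr_sumr -big_split /=.
  by apply: eq_bigr => j _; apply: sum_sq_mean.
have D0 y : 0 <= D y by apply: sumr_ge0 => j _; exact: sqr_ge0.
have V0 : 0 <= V by do 2![apply: sumr_ge0 => ? _]; exact: sqr_ge0.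
have Vle : V <= k%:R * d%:R / 4.
  (* Every bit is at distance 1/2 from 1/2, so this point costs exactly [k * d / 4], and [V] is no
     larger. *)
  have := costE (const_mx (1 / 2)).
  rewrite (eq_bigr (fun=> d%:R / 4)) => [|i _]; last first.
    rewrite (eq_bigr (fun=> 1 / 4)) => [|j _].
      by rewrite sumr_const card_ord -[LHS]mulr_natl mul1r.
    by rewrite mxE; case: (f i j) => /=; field.
  rewrite sumr_const card_ord -[_ *+ k]mulr_natl mulrA => ->.
  by rewrite lerDl mulr_ge0 // ltW.
move=> apx.
have {}apx : V + k%:R * D x <= (1 + eps) ^+ 2 * V.
  rewrite -costE -(sum_sq_hard_instance le_dn) //.
  apply: (@le_trans _ _ (((1 + eps) * l2norm (stackA R (hard_instance n f) *m m -
                            stackb R (hard_instance n f))) ^+ 2)).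
    rewrite lerXn2r ?nnegrE ?sqrtr_ge0 ?mulr_ge0 ?sqrtr_ge0 ?addr_ge0 ?(ltW eps_gt0) //.
    apply: (le_trans apx); rewrite ler_wpM2l ?lsq_opt_le //.
    by rewrite addr_ge0 // ltW.
  by rewrite exprMn sum_sq_hard_instance.
have -> : \sum_j (k%:R * x j ord0 - \sum_i (f i j)%:R) ^+ 2 = k%:R * (k%:R * D x).
  rewrite /D !mulr_sumr; apply: eq_bigr => j _; rewrite -mE; ring.
have d0 : 0 <= d%:R :> R by [].
(* With a single active server the fit is perfect, [V = 0], and the output is exact however large
   [eps] is. *)
case: k_small => [k1|ksm].
  have kR : k%:R = 1 :> R by rewrite k1.
  suff V00 : V = 0.
    move: apx; rewrite V00 mulr0 add0r => apx.
    apply: (@le_trans _ _ 0); last by rewrite divr_ge0.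
    by rewrite pmulr_rle0.
  rewrite /V big1 // => i _; rewrite big1 // => j _.
  have := mE j; rewrite (bigD1 i) //= big1 => [|i' ne].
    by rewrite kR mul1r addr0 => ->; rewrite subrr expr0n.
  by case/eqP: ne; apply/val_inj => /=; move: (ltn_ord i) (ltn_ord i'); lia.
have k1 : 1 <= k%:R :> R by rewrite ler1n.
have e1 : eps <= 1.
  have : eps <= eps * k%:R ^+ 2 by rewrite ler_peMr ?exprn_ege1 // ltW.
  by lra.
have {}apx : k%:R * D x <= 3 * eps * V.
  have : 0 <= eps * (1 - eps) * V by rewrite !mulr_ge0 ?subr_ge0 // ltW.
  by move: apx; set a := k%:R * _; nra.
apply: (@le_trans _ _ (k%:R * (3 * eps * (k%:R * d%:R / 4)))).
  rewrite ler_pM2l //; apply: (le_trans apx); apply: ler_wpM2l => //.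
  by rewrite mulr_ge0 // ltW.
have -> : k%:R * (3 * eps * (k%:R * d%:R / 4)) = 3 / 4 * d%:R * (eps * k%:R ^+ 2).
  by field.
nra.
Qed.

(** Column sums of the two inputs differ by [u j - v j], whose square indicates disagreement. Both
    are within squared distance [d / 256] of [k * x], and [(p + q) ^ 2 <= 2 * p ^ 2 + 2 * q ^ 2]
    gives [4 * (d / 256) = d / 64]. *)
Lemma hamming_close (f : {ffun 'I_k -> {ffun 'I_d -> bool}}) (i : 'I_k)
    (u v : {ffun 'I_d -> bool}) (x : 'cV[R]_d) :
  approx_lsq eps (stackA R (hard_instance n (upd f i u)))
    (stackb R (hard_instance n (upd f i u))) x ->
  approx_lsq eps (stackA R (hard_instance n (upd f i v)))
    (stackb R (hard_instance n (upd f i v))) x ->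
  (64 * hamming u v <= d)%N.
Proof.
move=> /approx_lsq_close cu /approx_lsq_close cv.
have hE : (hamming u v)%:R = \sum_j (\sum_i' (upd f i v i' j)%:R -
                                     \sum_i' (upd f i u i' j)%:R) ^+ 2 :> R.
  rewrite /hamming -sum1_card natr_sum big_mkcond /=; apply: eq_bigr => j _.
  rewrite -sumrB (bigD1 i) //= big1 => [|i' ne]; last first.
    by rewrite !ffunE (negbTE ne) subrr.
  rewrite !ffunE eqxx addr0 inE.
  by case: (u j) (v j) => [] []; rewrite /= ?subrr ?subr0 ?sub0r ?sqrrN ?expr1n ?expr0n.
have : (hamming u v)%:R <= 4 * (d%:R / 256) :> R.
  rewrite hE; apply: (@le_trans _ _ (\sum_j (
    2 * (k%:R * x j ord0 - \sum_i' (upd f i u i' j)%:R) ^+ 2 +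
    2 * (k%:R * x j ord0 - \sum_i' (upd f i v i' j)%:R) ^+ 2))).
    apply: ler_sum => j _.
    set a := \sum_i' _; set b := \sum_i' _; set y := k%:R * _.
    rewrite -subr_ge0; apply: le_trans (sqr_ge0 (y + y - a - b)) _.
    by rewrite le_eqVlt; apply/orP; left; apply/eqP; ring.
  rewrite big_split /= -!mulr_sumr; lra.
move=> h; rewrite -(ler_nat R) natrM; lra.
Qed.

End Closeness.

Lemma expr_le_base (R : realType) (x : R) (m : nat) :
  0 <= x -> x <= 1 -> (0 < m)%N -> x ^+ m <= x.
Proof. by move=> x0 x1; case: m => // m _; rewrite exprS ler_piMr ?exprn_ile1. Qed.

(** * Inputs solved by one deterministic protocol *)

Section Deterministic.
Variables (R : realType) (s d : nat) (n : 'I_s -> nat).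
Hypothesis le_dn : forall i, (d <= n i)%N.
Variables (k : nat) (eps : R).
Hypotheses (k_gt0 : (0 < k)%N) (le_ks : (k <= s)%N) (eps_gt0 : 0 < eps).
Hypothesis k_small : k = 1%N \/ eps * k%:R ^+ 2 <= 256^-1.
Hypothesis d_gt0 : (0 < d)%N.
Variables (pi : protocol R d n) (C : nat).

Local Notation input := {ffun 'I_k -> {ffun 'I_d -> bool}}.

Hypothesis le_C : forall (f : input) t,
  (size (board pi (hard_instance n f) t) <= C)%N.

Definition solved_inputs : {set input} :=
  [set f : input | `[< exists2 x, stops_with pi (hard_instance n f) x &
     approx_lsq eps (stackA R (hard_instance n f)) (stackb R (hard_instance n f)) x >]].

(** Under [le_C] this is the final board; runs may stop early, hence strings of length at most
    [C]. *)
Definition transcript (f : input) : {bseq C of bool} :=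
  Bseq (size_board pi (hard_instance n f) C).

Lemma transcript_exchangeable : exchangeable transcript.
Proof.
move=> f g i /(congr1 val) /= e; apply/val_inj => /=.
by apply: board_exchange e => i0; apply: hard_instance_upd.
Qed.

(** Equal transcripts give equal outputs, so all solved points of the line lie in a Hamming ball
    around any one of them. *)
Lemma card_solved_line (g : input) (i : 'I_k) :
  #|[set u | upd g i u \in solved_inputs :&: fiber transcript (transcript g)]|%:R
    <= (9 / 8 : R) ^+ d.
Proof.
set S := [set u | _].
have [->|[v vS]] := finset.set_0Vmem S; first by rewrite cards0 exprn_ge0.
apply: le_trans (card_hamming_ball R v); rewrite ler_nat.
apply/subset_leq_card/fintype.subsetP => u uS; rewrite inE.
have S_out w : w \in S -> approx_lsq eps (stackA R (hard_instance n (upd g i w)))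
    (stackb R (hard_instance n (upd g i w))) (output pi (val (transcript g))).
  rewrite !inE => /andP[/asboolP[x /(stops_with_output (le_C _)) ->]] + /eqP e.
  by rewrite -e.
exact: (hamming_close le_dn k_gt0 le_ks eps_gt0 k_small (S_out u uS) (S_out v vS)).
Qed.

Let card_bits : #|{ffun 'I_d -> bool}| = (2 ^ d)%N.
Proof. by rewrite card_ffun card_bool card_ord. Qed.

Lemma card_solved :
  #|solved_inputs|%:R <=
  2 ^+ C.+1 * (3 / 2) ^+ (d * k) + 3 / 4 * (2 : R) ^+ (d * k).
Proof.
have B0 : 0 <= (9 / 8 : R) ^+ d by rewrite exprn_ge0.
have t0 : 0 < (3 / 2 : R) ^+ d by rewrite exprn_gt0.
have := card_rectangle_cover B0 t0 transcript_exchangeable card_solved_line.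
rewrite card_bits card_ord natrX -!exprM => /le_trans; apply.
rewrite lerD // ler_wpM2r ?exprn_ge0 //.
  by rewrite -natrX ler_nat ltnW // card_transcripts.
rewrite -expr_div_n (_ : 9 / 8 / (3 / 2) = 3 / 4 :> R); last by field.
by apply: expr_le_base => //; lra.
Qed.

(** For small [d * k] the first term of [card_solved] is too large when [C = 0]. Here all inputs
    share one transcript with full shadows, so the solved fraction is at most [(9 / 16) ^+ d]. *)
Lemma card_solved_silent : C = 0%N ->
  #|solved_inputs|%:R <= 3 / 4 * (2 : R) ^+ (d * k).
Proof.
move=> C0; pose g : input := [ffun=> [ffun=> false]]; pose l := transcript g.
have fiberT : fiber transcript l = finset.setT.
  apply/setP => f; rewrite !inE; apply/eqP/val_inj.
  have nil (w : {bseq C of bool}) : val w = [::].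
    by apply/nilP; have := size_bseq w; rewrite {2}C0 leqn0.
  by rewrite !nil.
have i : 'I_k by exact: Ordinal k_gt0.
have shadowT : shadow transcript i l = finset.setT.
  apply/setP => u; rewrite inE; apply/imsetP.
  by exists [ffun=> u]; rewrite ?fiberT ?inE ?ffunE.
have line f : transcript f = l ->
    #|[set u | upd f i u \in solved_inputs :&: fiber transcript l]|%:R
      <= (9 / 8 : R) ^+ d.
  by move=> <-; exact: card_solved_line.
have := card_fiber_line transcript_exchangeable line.
rewrite shadowT fiberT finset.setIT !cardsT [#|{ffun 'I_k -> _}|]card_ffun.
rewrite card_bits card_ord !natrX -exprM => h.
have p0 : 0 < (2 : R) ^+ d by rewrite exprn_gt0.
rewrite -(ler_pM2r p0) (le_trans h) // mulrC mulrAC ler_pM2r ?exprn_gt0 //.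
have -> : (9 / 8 : R) ^+ d = (9 / 16) ^+ d * 2 ^+ d.
  by rewrite -exprMn; congr (_ ^+ _); field.
have : (9 / 16 : R) ^+ d <= 9 / 16 by apply: expr_le_base => //; lra.
by rewrite ler_pM2r // => /le_trans; apply; lra.
Qed.

End Deterministic.

(** * Averaging over the coins and the final estimate *)

Lemma mean_count_le (R : realType) (disp : measure_display)
    (Omega : measurableType disp) (P : probability Omega R) (F : finType)
    (E : F -> set Omega) (p b : R) :
  (forall x, measurable (E x)) -> (forall x, (p%:E <= P (E x))%E) ->
  (forall w, \sum_x (\1_(E x) w : R) <= b) -> p * #|F|%:R <= b.
Proof.
move=> mE pE bE; rewrite -lee_fin.
(* This sum is the expected number of events that occur, and [b] bounds that number pointwise. *)
apply: (@le_trans _ _ (\sum_x P (E x))%E).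
  rewrite mulr_natr -sumr_const -sumEFin; exact: lee_sum.
have mI x : measurable_fun [set: Omega]%classic (EFin \o (\1_(E x) : Omega -> R)).
  by apply/measurable_EFinP; exact: measurable_indic.
rewrite (eq_bigr (fun x => \int[P]_w (\1_(E x) w)%:E)%E); last first.
  by move=> x _; rewrite integral_indic // setIT.
rewrite -ge0_integral_sum //.
have -> : b%:E = (\int[P]_w (cst b%:E) w)%E.
  by rewrite integral_cst // [X in (_ * X)%E](probability_setT P) mule1.
apply: ge0_le_integral => //.
- by move=> w _; apply: sume_ge0.
- exact: emeasurable_sum.
- by move=> w _; rewrite sumEFin lee_fin.
Qed.

Lemma comm_ge (R : realType) (m C : nat) : (0 < C)%N ->
  99 / 100 * (2 : R) ^+ m <= 2 ^+ C.+1 * (3 / 2) ^+ m + 3 / 4 * 2 ^+ m ->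
  (m <= 15 * C)%N.
Proof.
move=> C0 h.
have t0 : 0 < (3 / 2 : R) ^+ m by rewrite exprn_gt0.
have qE : (2 : R) ^+ m = (4 / 3) ^+ m * (3 / 2) ^+ m.
  by rewrite -exprMn; congr (_ ^+ _); field.
have h1 : (4 / 3 : R) ^+ m <= 2 ^+ (5 * C).
  have : 24 / 100 * (4 / 3 : R) ^+ m <= 2 ^+ C.+1.
    by rewrite -(ler_pM2r t0) -[leLHS]mulrA -qE; lra.
  (* [C + 4 <= 5 * C] since [C > 0], and 8 exceeds 100/24. *)
  have : (2 : R) ^+ C.+1 * 8 <= 2 ^+ (5 * C).
    have -> : 8 = 2 ^+ 3 :> R by rewrite -natrX.
    by rewrite -exprD ler_weXn2l ?ler1n //; lia.
  have : 0 <= (4 / 3 : R) ^+ m by rewrite exprn_ge0.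
  by lra.
have h2 : (2 : R) ^+ m <= 2 ^+ (15 * C).
  rewrite (_ : 15 * C = 5 * C * 3)%N; last by lia.
  (* Cubing suffices because [(4 / 3) ^ 3 = 64 / 27] is at least 2. *)
  rewrite exprM; apply: (@le_trans _ _ (((4 / 3) ^+ m) ^+ 3)).
    rewrite -exprM mulnC exprM lerXn2r ?nnegrE ?exprn_ge0 //.
    by rewrite !exprS expr0; lra.
  by rewrite lerXn2r ?nnegrE ?exprn_ge0.
by move: h2; rewrite ler_eXn2l // ltr1n.
Qed.

Theorem theorem5p3 (R : realType) :
  exists2 c : R, 0 < c &
  exists2 c' : R, 0 < c' &
    forall (s d M : nat) (eps : R),
      (0 < M)%N -> 0 < eps ->
      c / Num.sqrt eps <= s%:R ->
    forall n : 'I_s -> nat, (forall i : 'I_s, (d <= n i)%N) ->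
    forall (disp : measure_display) (Omega : measurableType disp)
           (P : probability Omega R) (Pi : rprotocol R d n Omega),
      solves_regression P Pi eps (99%:R / 100%:R) M ->
    forall C : nat, comm_at_most Pi M C ->
      c' * (d%:R / Num.sqrt eps) <= C%:R.
Proof.
(* The square of 1/16 is the 1/256 required of [eps * k ^ 2]. Below, 480 is 16 from this scaling,
   times 2 from rounding [y] to [k], times 15 from [comm_ge]. *)
exists (1 / 16); first by lra.
exists (1 / 480); first by lra.
move=> s d M eps M0 eps0 le_s n le_dn disp Omega P Pi sol C comm.
have [->|d0] := posnP d; first by rewrite mul0r mulr0.
have q0 : 0 < Num.sqrt eps by rewrite sqrtr_gt0.
set y := 1 / 16 / Num.sqrt eps in le_s.
have y0 : 0 < y by rewrite divr_gt0 // divr_gt0.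
(* The maximum keeps one active server when [eps] is so large that [y < 1]. *)
pose k := maxn 1 (Num.truncn y).
have k0 : (0 < k)%N by rewrite leq_max.
have ty : (Num.truncn y)%:R <= y by rewrite truncn_le ltW.
have ks : (k <= s)%N.
  rewrite geq_max -(ltr0n R) (lt_le_trans y0 le_s) /= -(ler_nat R).
  exact: le_trans ty le_s.
have yk : y <= 2 * k%:R.
  apply: le_trans (ltW (truncnS_gt y)) _.
  by rewrite -natrM ler_nat /k; case: (Num.truncn y) => [|t]; lia.
have ksm : k = 1%N \/ eps * k%:R ^+ 2 <= 256^-1.
  have [t1|t1] := leqP (Num.truncn y) 1; first by left; apply/maxn_idPl.
  right; have -> : k = Num.truncn y by apply/maxn_idPr/ltnW.
  apply: (@le_trans _ _ (eps * y ^+ 2)).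
    by rewrite ler_pM2l // lerXn2r ?nnegrE // ltW.
  rewrite /y exprMn exprVn sqr_sqrtr ?(ltW eps0) // mulrC divfK ?gt_eqF //.
  by rewrite expr2; lra.
have bound (b : R) :
    (forall w, #|solved_inputs k eps (Pi w)|%:R <= b) ->
    99 / 100 * (2 : R) ^+ (d * k) <= b.
  move=> hb.
  have -> : (2 : R) ^+ (d * k) = #|{ffun 'I_k -> {ffun 'I_d -> bool}}|%:R.
    by rewrite !card_ffun card_bool !card_ord !natrX -exprM.
  apply: (mean_count_le (P := P)
    (E := fun f => success_event Pi eps (hard_instance n f))).
  - by move=> f; have [] := sol _ (hard_instance_bounded f M0).
  - by move=> f; have [] := sol _ (hard_instance_bounded f M0).
  move=> w; apply: le_trans (hb w).
  rewrite -sum1_card natr_sum [leRHS]big_mkcond /=; apply: ler_sum => f _.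
  rewrite indicE; have [wE|wE] := boolP (w \in _); last by case: ifP.
  by rewrite ifT // inE; apply/asboolP; move: wE; rewrite inE.
have leC w (f : {ffun 'I_k -> {ffun 'I_d -> bool}}) t :
    (size (board (Pi w) (hard_instance n f) t) <= C)%N.
  exact/comm/hard_instance_bounded.
(* Silence is impossible, as 3/4 is below 99/100. *)
have [C0|C0] := posnP C.
  have := bound _ (fun w =>
    card_solved_silent le_dn k0 ks eps0 ksm d0 (leC w) C0).
  have : 0 < (2 : R) ^+ (d * k) by rewrite exprn_gt0.
  by lra.
have := bound _ (fun w => card_solved le_dn k0 ks eps0 ksm d0 (leC w)).
move/(comm_ge C0); rewrite -(ler_nat R) !natrM => dk.
have -> : d%:R / Num.sqrt eps = 16 * (d%:R * y) by rewrite /y; field; rewrite gt_eqF.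
have : d%:R * y <= d%:R * (2 * k%:R) by rewrite ler_wpM2l.
by lra.
Qed.
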